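(* Let $\Omega$, $F$, $K$, $e$ be as in the context. Let $p\in\mathbb{N}$ and $\varepsilon\ge0$. Then (i) $\varepsilon\text{-}\operatorname{wargmin}_x(\mathcal{VP}_p)\subseteq\varepsilon\text{-}\operatorname{wargmin}(\mathcal{SP})$; (ii) $\varepsilon\text{-}\operatorname{argmin}_x(\mathcal{VP}_p)\subseteq\varepsilon\text{-}\operatorname{argmin}^{II}(\mathcal{SP})$.
   Context: $\mathbb{N}=\{1,2,\ldots\}$ and $[p]=\{1,\ldots,p\}$. Setting: $\Omega\subseteq\mathbb{R}^n$ is nonempty and closed; $F:\mathbb{R}^n\rightrightarrows\mathbb{R}^m$ is a set-valued mapping with $\Omega\subseteq \operatorname{dom}F:=\{x: F(x)\neq\emptyset\}$ and $F(x)$ compact for every $x\in\Omega$; $K\subseteq\mathbb{R}^m$ is a closed, convex, pointed ($K\cap(-K)=\{0\}$), solid ($\operatorname{int}K\ne\emptyset$) cone; $e\in\operatorname{int}K$ is fixed. Set optimization problem $(\mathcal{SP})$: minimize $F(x)$ over $x\in\Omega$ with respect to the lower set less relation. For $\varepsilon\ge 0$, a point $\bar x\in\Omega$ is an $\varepsilon$-weakly minimal solution of $(\mathcal{SP})$ if there is no $x\in\Omega$ with $F(\bar x)-\varepsilon e\subseteq F(x)+\operatorname{int}K$; it is a type-two $\varepsilon$-minimal solution if there is no $x\in\Omega$ with $F(\bar x)-\varepsilon e\subseteq F(x)+K\setminus\{0\}$. The sets of these solutions are denoted $\varepsilon\text{-}\operatorname{wargmin}(\mathcal{SP})$ and $\varepsilon\text{-}\operatorname{argmin}^{II}(\mathcal{SP})$,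 respectively. Multiobjective problem $(\mathcal{VP}_p)$, $p\in\mathbb{N}$: minimize $(y^1,\ldots,y^p)\in\mathbb{R}^{mp}$ with respect to the cone $K^p=\prod_{i=1}^pK$ over all feasible $(x,y^1,\ldots,y^p)$, i.e. $x\in\Omega$ and $y^i\in F(x)$ for all $i\in[p]$. For $\varepsilon\ge0$, a feasible $(\bar x,\bar y^1,\ldots,\bar y^p)$ is an $\varepsilon$-weakly minimal solution if there is no feasible $(x,y^1,\ldots,y^p)$ with $\bar y^i-\varepsilon e-y^i\in\operatorname{int}K$ for all $i\in[p]$; it is an $\varepsilon$-minimal solution if there is no feasible $(x,y^1,\ldots,y^p)$ with $(\bar y^1-\varepsilon e-y^1,\ldots,\bar y^p-\varepsilon e-y^p)\in K^p\setminus\{0\}$. The sets $\varepsilon\text{-}\operatorname{wargmin}_x(\mathcal{VP}_p)$ and $\varepsilon\text{-}\operatorname{argmin}_x(\mathcal{VP}_p)$ are the projections onto the $x$-component in $\mathbb{R}^n$ of the sets of $\varepsilon$-weakly minimal and $\varepsilon$-minimal solutions of $(\mathcal{VP}_p)$, respectively. *)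

(* Defs.v *)
From mathcomp Require Import all_boot all_order all_algebra.
From mathcomp Require Import all_classical all_reals all_analysis.
Import Order.TTheory GRing.Theory Num.Theory.
Import numFieldNormedType.Exports.

Set Implicit Arguments.
Unset Strict Implicit.
Unset Printing Implicit Defensive.

Local Open Scope classical_set_scope.
Local Open Scope ring_scope.

Section Cones.
Context {R : realType} {m : nat}.
Implicit Types A B K : set 'rV[R]_m.

Definition minkowski_add A B : set 'rV[R]_m :=
  [set a + b | a in A & b in B].

Definition translate A (v : 'rV[R]_m) : set 'rV[R]_m := [set a + v | a in A].

Definition is_cone K := forall (t : R) y, 0 <= t -> K y -> K (t *: y).

Definition pointed_cone K := K `&` [set - y | y in K] = [set 0].

Definition solid K := K° !=set0.

(* Vectors of R^(mp) are split into p blocks of length m. *)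
Definition cone_power (p : nat) K : set {ffun 'I_p -> 'rV[R]_m} :=
  [set Y | forall i, K (Y i)].

End Cones.

Section Problems.
Context {R : realType} {n m : nat}.
Variables (Omega : set 'rV[R]_n) (F : 'rV[R]_n -> set 'rV[R]_m).
Variables (K : set 'rV[R]_m) (e : 'rV[R]_m) (eps : R).

Definition dom_setmap : set 'rV[R]_n := [set x | F x !=set0].

Definition wargmin_SP : set 'rV[R]_n :=
  [set xbar | Omega xbar /\
    ~ exists2 x, Omega x &
        translate (F xbar) (- (eps *: e)) `<=` minkowski_add (F x) K°].

Definition argminII_SP : set 'rV[R]_n :=
  [set xbar | Omega xbar /\
    ~ exists2 x, Omega x &
        translate (F xbar) (- (eps *: e)) `<=`
        minkowski_add (F x) (K `\` [set 0])].

Variable p : nat.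

Definition feasible_VP : set ('rV[R]_n * {ffun 'I_p -> 'rV[R]_m}) :=
  [set z : _ * {ffun _} | Omega z.1 /\ forall i : 'I_p, F z.1 (z.2 i)].

Definition wmin_VP : set ('rV[R]_n * {ffun 'I_p -> 'rV[R]_m}) :=
  [set zbar : _ * {ffun _} | feasible_VP zbar /\
    ~ exists2 z, feasible_VP z &
        forall i : 'I_p, K° (zbar.2 i - eps *: e - z.2 i)].

Definition min_VP : set ('rV[R]_n * {ffun 'I_p -> 'rV[R]_m}) :=
  [set zbar : _ * {ffun _} | feasible_VP zbar /\
    ~ exists2 z, feasible_VP z &
        (cone_power K `\` [set 0])
          [ffun i => zbar.2 i - eps *: e - z.2 i]].

Definition wargmin_x_VP : set 'rV[R]_n := [set z.1 | z in wmin_VP].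

Definition argmin_x_VP : set 'rV[R]_n := [set z.1 | z in min_VP].

End Problems.

(* Main.v *)
(** If every point of [F xbar - eps e] dominates a point of [F x], then so do the
    p chosen points [ybar i - eps e]; the p dominated points, taken together
    with x, contradict the minimality of [(xbar, ybar)] in (VP_p). *)

Require Import Defs.
From mathcomp Require Import all_boot all_order all_algebra.
From mathcomp Require Import all_classical all_reals all_analysis.
Import Order.TTheory GRing.Theory Num.Theory.
Import numFieldNormedType.Exports.

Local Open Scope classical_set_scope.
Local Open Scope ring_scope.

(** Each [Y i - v] lies in the translate, hence splits as [b + d] with [b] in [B] and [d] in [D];
    choosing one such [b] per index gives [Z]. With [B := F x], the pair [(x, Z)] is feasible for
    (VP_p) whenever [x] is in [Omega]; [D] is the interior of [K] in (i) and [K] without the origin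
    in (ii). *)
Lemma minkowski_add_select (R : realType) (m p : nat)
    (A B D : set 'rV[R]_m) (v : 'rV[R]_m) (Y : {ffun 'I_p -> 'rV[R]_m}) :
  translate A (- v) `<=` minkowski_add B D -> (forall i, A (Y i)) ->
  exists Z : {ffun 'I_p -> 'rV[R]_m},
    (forall i, B (Z i)) /\ (forall i, D (Y i - v - Z i)).
Proof.
move=> ABD AY.
have sel i : exists z, B z /\ D (Y i - v - z).
  have [|b Bb [d Dd bd]] := ABD (Y i - v); first by exists (Y i).
  by exists b; split => //; rewrite -bd addrAC subrr add0r.
have [z Bz] := choice sel.
by exists (finfun z); split=> i; rewrite ffunE; have [] := Bz i.
Qed.

Theorem proposition3p2 (R : realType) (n m : nat)
    (Omega : set 'rV[R]_n) (F : 'rV[R]_n -> set 'rV[R]_m)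
    (K : set 'rV[R]_m) (e : 'rV[R]_m)
    (Omega_nonempty : Omega !=set0)
    (Omega_closed : closed Omega)
    (Omega_dom : Omega `<=` dom_setmap F)
    (F_compact : forall x, Omega x -> compact (F x))
    (K_closed : closed K)
    (K_cone : is_cone K)
    (K_convex : convex_set K)
    (K_pointed : pointed_cone K)
    (K_solid : solid K)
    (e_int : K° e)
    (p : nat) (p_gt0 : (0 < p)%N)
    (eps : R) (eps_ge0 : 0 <= eps) :
  (wargmin_x_VP Omega F K e eps p `<=` wargmin_SP Omega F K e eps) /\
  (argmin_x_VP Omega F K e eps p `<=` argminII_SP Omega F K e eps).
Proof.
split=> _ [[xbar ybar] [[/= Oxbar Fybar] nodom] <-] /=.
  split=> // -[x Ox dom]; apply: nodom.
  have [y [Fy Ky]] := minkowski_add_select _ _ _ _ _ _ _ _ dom Fybar.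
  by exists (x, y).
split=> // -[x Ox dom]; apply: nodom.
have [y [Fy Ky]] := minkowski_add_select _ _ _ _ _ _ _ _ dom Fybar.
(* If the tuple of differences were zero, so would be its block at index 0, which exists because [p]
   is positive; but every block lies in [K] without the origin. *)
exists (x, y) => //; split=> /= [i|/ffunP/(_ (Ordinal p_gt0))].
  by rewrite ffunE; have [] := Ky i.
by rewrite !ffunE; have [_] := Ky (Ordinal p_gt0).
Qed.
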